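(* Let $n,m,m'\ge 1$ be integers and let $T=1^{k_1} i_2^{k_2}\cdots i_r^{k_r}$ be a type with $r\ge 2$, $1<i_2<\cdots<i_r$, all $k_j\ge 1$, $n=k_1+\sum_{j=2}^r k_j i_j$, satisfying \[ \left\lceil\frac{k_1}{k_2+\cdots+k_r}\right\rceil\ge (\max\{m,m'\}-1)(i_r-1). \] Let $\mathcal{P}_m$ and $\mathcal{P}_{m'}$ be the sets of $m$-AP-partitions and $m'$-AP-partitions of $\mathbb{Z}_n$ of type $T$. Then the separation algorithm $\psi:\mathcal{P}_m\to\mathcal{P}_{m'}$ is a bijection; its inverse is the map $\varphi:\mathcal{P}_{m'}\to\mathcal{P}_m$ given by the separation algorithm with the roles of $m$ and $m'$ interchanged.
   Context: $\mathbb{Z}_n$ has elements $1,\ldots,n$ placed clockwise on a directed cycle. An $m$-AP-block of length $i$ is a sequence $(x,x+m,\ldots,x+(i-1)m)\pmod n$ of $i$ distinct elements; $x$ is its head; a block of length 1 is a singleton. An $m$-AP-partition is a set of $m$-AP-blocks whose underlying sets partition $\mathbb{Z}_n$; its type is $1^{k_1}i_2^{k_2}\cdots i_r^{k_r}$ if it has $k_1$ blocks of length 1 and $k_j$ blocks of length $i_j$. For an $m$-AP-partition $\pi$ and a head $h$ of $\pi$, let $h^*$ be the first head of a non-singleton block of $\pi$ met among $h-1,h-2,\ldots,h-n \pmod n$, and let $g(h)$ be the number of singleton elements on the path $h^*, h^*+1,\ldots,h$, not counting $h$. Separation algorithm from $m$ to $m'$ (denoted $\psi$): given $\pi\in\mathcal{P}_m$,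 choose a head $h_1$ of $\pi$ with $g(h_1)$ maximum (the result does not depend on this choice), and linearly order $\mathbb{Z}_n$ as $h_1<h_1+1<\cdots<h_1-1 \pmod n$. List the heads of $\pi$ as $h_1<\cdots<h_t$ in this order, let $B_i$ be the block with head $h_i$ and $l_i$ its length. Put $h_1'=h_1$, $B_1'=(h_1',h_1'+m',\ldots,h_1'+(l_1-1)m')$; for $i=2,\ldots,t$, let $h_i'$ be the smallest element not lying in $B_1',\ldots,B_{i-1}'$ and $B_i'=(h_i',h_i'+m',\ldots,h_i'+(l_i-1)m')$. Set $\psi(\pi)=\{B_1',\ldots,B_t'\}$, which under the stated condition lies in $\mathcal{P}_{m'}$. The map $\varphi$ is defined identically with $m$ and $m'$ swapped. *)

(* Defs.v *)
From HB Require Import structures.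
From mathcomp Require Export all_boot all_order all_algebra.
From mathcomp Require Export finmap.
From mathcomp Require Export boolp classical_sets functions.

Set Implicit Arguments.
Unset Strict Implicit.
Unset Printing Implicit Defensive.

Import GRing.Theory.

Local Open Scope ring_scope.

(* The cycle is the ring 'Z_n: its elements are the residues 0, ..., n-1, with 0
   in the place of the element n.  Every definition is meant for 1 < n ('Z_n is
   Z/2 for n <= 1). *)

Definition ap_seq (n m : nat) (x : 'Z_n) (l : nat) : seq 'Z_n :=
  mkseq (fun j => x + (j * m)%:R) l.

(* Blocks are sequences, not sets: a block that goes once around a coset of the
   subgroup generated by m has the same elements for every choice of its head. *)
Definition is_ap_block (n m : nat) (B : seq 'Z_n) : Prop :=
  [/\ (0 < size B)%N, uniq B & B = ap_seq m (head 0 B) (size B)].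

Definition is_ap_partition (n m : nat) (pi : {fset seq 'Z_n}) : Prop :=
  (forall B, B \in pi -> is_ap_block m B) /\
  (forall x : 'Z_n, exists! B, B \in pi /\ x \in B).

Definition nblocks (n : nat) (pi : {fset seq 'Z_n}) (l : nat) : nat :=
  count (fun B => size B == l) (enum_fset pi).

(* In the type 1^(k 1) (i 2)^(k 2) ... (i r)^(k r), only k 1, ..., k r and
   i 2, ..., i r matter.  Other block lengths are excluded once
   n = k 1 + \sum_(2 <= j < r.+1) k j * i j. *)
Definition has_type (n r : nat) (i k : nat -> nat) (pi : {fset seq 'Z_n}) : Prop :=
  nblocks pi 1 = k 1%N /\
  (forall j, (2 <= j <= r)%N -> nblocks pi (i j) = k j).

Definition ap_partitions (n m r : nat) (i k : nat -> nat) : set {fset seq 'Z_n} :=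
  [set pi | is_ap_partition m pi /\ has_type r i k pi]%classic.

Definition is_head (n : nat) (pi : {fset seq 'Z_n}) (x : 'Z_n) : bool :=
  has (fun B => head 0 B == x) (enum_fset pi).

Definition is_nonsingleton_head (n : nat) (pi : {fset seq 'Z_n}) (x : 'Z_n) : bool :=
  has (fun B => (head 0 B == x) && (1 < size B)%N) (enum_fset pi).

(* The least d in {1, ..., n} such that h - d is the head of a non-singleton
   block; thus h^* = h - d, with d = n (a full turn) when h^* = h. *)
Definition star_dist (n : nat) (pi : {fset seq 'Z_n}) (h : 'Z_n) : nat :=
  (find (fun j => is_nonsingleton_head pi (h - j%:R)) (iota 1 n)).+1.

Definition star (n : nat) (pi : {fset seq 'Z_n}) (h : 'Z_n) : 'Z_n :=
  h - (star_dist pi h)%:R.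

(* The path h^*, h^* + 1, ..., h without its final vertex h. *)
Definition gap (n : nat) (pi : {fset seq 'Z_n}) (h : 'Z_n) : nat :=
  count (fun x => [:: x] \in pi)
    [seq star pi h + j%:R | j <- iota 0 (star_dist pi h)].

Definition is_start (n : nat) (pi : {fset seq 'Z_n}) (h : 'Z_n) : bool :=
  is_head pi h && [forall x, is_head pi x ==> (gap pi x <= gap pi h)%N].

(* The position, from 0, of x in the order h1 < h1 + 1 < ... < h1 - 1. *)
Definition pos (n : nat) (h1 x : 'Z_n) : nat := val (x - h1).

(* The blocks B_1, ..., B_t, in the order of their heads. *)
Definition ordered_blocks (n : nat) (h1 : 'Z_n) (pi : {fset seq 'Z_n}) : seq (seq 'Z_n) :=
  sort (fun B C : seq 'Z_n => pos h1 (head 0%R B) <= pos h1 (head 0%R C))%N (enum_fset pi).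

Definition first_free (n : nat) (h1 : 'Z_n) (occ : seq 'Z_n) : 'Z_n :=
  head h1 [seq x <- [seq h1 + j%:R | j <- iota 0 n] | x \notin occ].

(* The blocks built from the lengths ls when the elements of occ are already
   covered; for occ empty, the first new head is h1 itself. *)
Fixpoint place_blocks (n m' : nat) (h1 : 'Z_n) (occ : seq 'Z_n) (ls : seq nat)
    : seq (seq 'Z_n) :=
  if ls is l :: ls' then
    let B := ap_seq m' (first_free h1 occ) l in
    B :: place_blocks m' h1 (occ ++ B) ls'
  else [::].

Definition separation_from (n m' : nat) (h1 : 'Z_n) (pi : {fset seq 'Z_n})
    : {fset seq 'Z_n} :=
  [fset B in place_blocks m' h1 [::] [seq size C | C <- ordered_blocks h1 pi]]%fset.

(* The separation algorithm to m'.  The source m is not an argument: a block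
   carries its head and its length, and nothing else is used. *)
Definition separation (n m' : nat) (pi : {fset seq 'Z_n}) : {fset seq 'Z_n} :=
  separation_from m' (odflt 0 [pick h | is_start pi h]) pi.

(* Main.v *)
Require Import Defs.
From mathcomp Require Import zify.

Set Implicit Arguments.
Unset Strict Implicit.
Unset Printing Implicit Defensive.

Import Order.TTheory GRing.Theory Num.Theory.

(** Read the blocks in the order of their heads from a head [h]; the value [gap]
    at [h] is the length of the final run of singletons of the list of lengths.
    For a start [h] this run is maximal, hence at least k_1 / (k_2 + ... + k_r),
    hence at least (max(m, m') - 1) (i_r - 1).  A block that went past [h] would
    have to skip the whole final run and [h] itself, but it has at most
    (m - 1) (i_r - 1) gaps.  So, cut at [h], no block wraps around, every head is
    the least element not covered by the previous blocks, and the partition is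
    recovered from [h] and the list of lengths by the greedy placement with step m.
    By the same count the greedy placement of that list with step m' stays within
    the n positions, so it yields an m'-AP-partition with the same list of
    lengths; as the gaps only depend on this list, [h] is again a start, and the
    two algorithms undo each other. *)

Local Open Scope nat_scope.

(** * Greedy placement of progressions in the natural numbers *)

Definition nat_ap (m x l : nat) : seq nat := mkseq (fun j => x + j * m) l.

(** One of the first [size occ + 1] naturals is missing from [occ], so the search always
    succeeds. *)
Definition least_free (occ : seq nat) : nat :=
  find (fun x => x \notin occ) (iota 0 (size occ).+1).

Fixpoint greedy (m : nat) (occ : seq nat) (ls : seq nat) : seq (seq nat) :=
  if ls is l :: ls' then
    let B := nat_ap m (least_free occ) l in B :: greedy m (occ ++ B) ls'
  else [::].

Definition trail (ls : seq nat) : nat := find (predC1 1) (rev ls).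

(** The form in which the ceiling condition is used, with [M] a bound on both steps: a block of
    length [l] has at most [(M - 1) * (l - 1)] points in its gaps, no more than there are singletons
    at the end. *)
Definition good (M : nat) (ls : seq nat) : bool :=
  all (fun l => (0 < l) && ((M - 1) * (l - 1) <= trail ls)) ls.

Lemma least_freeP (occ : seq nat) :
  least_free occ \notin occ /\ forall z, z < least_free occ -> z \in occ.
Proof.
have hf : has (fun x => x \notin occ) (iota 0 (size occ).+1).
  apply/negPn; rewrite -all_predC; apply/negP => /allP h.
  have := @uniq_leq_size _ (iota 0 (size occ).+1) occ (iota_uniq _ _).
  rewrite size_iota ltnn => h2; suff: false by [].
  by apply: h2 => x /h /=; rewrite negbK.
have hs := hf; rewrite has_find size_iota in hs.
split.
  by have := nth_find 0 hf; rewrite nth_iota.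
move=> z hz; have := before_find 0 hz.
rewrite nth_iota ?add0n; first by move/negbFE.
by apply: ltn_trans hz hs.
Qed.

Lemma least_free_notin (occ : seq nat) : least_free occ \notin occ.
Proof. by case: (least_freeP occ). Qed.

Lemma least_free_below (occ : seq nat) z : z < least_free occ -> z \in occ.
Proof. by case: (least_freeP occ) => _; apply. Qed.

Lemma least_free_eq (occ : seq nat) x :
  x \notin occ -> (forall z, z < x -> z \in occ) -> least_free occ = x.
Proof.
move=> hx hz; case: (ltngtP (least_free occ) x) => //.
  by move/hz; rewrite (negPf (least_free_notin occ)).
by move/least_free_below; rewrite (negPf hx).
Qed.

Lemma nat_apP m x l y :
  reflect (exists2 j, j < l & y = x + j * m) (y \in nat_ap m x l).
Proof.
apply: (iffP mapP) => [[j]|[j hj ->]]; first by rewrite mem_iota /= => h ->; exists j.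
by exists j => //; rewrite mem_iota.
Qed.

Lemma size_nat_ap m x l : size (nat_ap m x l) = l.
Proof. exact: size_mkseq. Qed.

Lemma nat_ap_uniq m x l : 0 < m -> uniq (nat_ap m x l).
Proof. by move=> hm; apply/mkseq_uniq => i j; nia. Qed.

(** The [j * m + 1] points from [x] to [x + j * m] contain [j + 1] terms of the progression, both
    ends included, and [ys] lies among the others. *)
Lemma count_gaps m x j (ys : seq nat) : 0 < m -> uniq ys ->
  (forall y, y \in ys -> x < y < x + j * m) ->
  (forall y, y \in ys -> y \notin nat_ap m x j) -> size ys <= j * (m - 1).
Proof.
move=> hm huq hlt hnot.
have : size (ys ++ nat_ap m x j.+1) <= size (iota x (j * m).+1).
  apply: uniq_leq_size.
    rewrite cat_uniq huq nat_ap_uniq // andbT -all_predC; apply/allP => y /nat_apP[i hi ->] /=.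
    apply/negP => hin; move: (hlt _ hin) (hnot _ hin) => hb /nat_apP[]; exists i => //.
    by nia.
  move=> y; rewrite mem_cat mem_iota => /orP[/hlt|/nat_apP[i hi ->]]; nia.
rewrite size_cat size_nat_ap size_iota; nia.
Qed.

Lemma size_greedy m occ ls : size (greedy m occ ls) = size ls.
Proof. by elim: ls occ => //= l ls IH occ; rewrite IH. Qed.

Lemma greedy_sizes m occ ls : [seq size B | B <- greedy m occ ls] = ls.
Proof. by elim: ls occ => //= l ls IH occ; rewrite IH size_nat_ap. Qed.

Lemma size_flatten_greedy m occ ls : size (flatten (greedy m occ ls)) = sumn ls.
Proof. by rewrite size_flatten /shape greedy_sizes. Qed.

Lemma greedy_cat m occ ls1 ls2 :
  greedy m occ (ls1 ++ ls2) =
  greedy m occ ls1 ++ greedy m (occ ++ flatten (greedy m occ ls1)) ls2.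
Proof.
elim: ls1 occ => [|l ls1 IH] occ /=; first by rewrite cats0.
by rewrite IH catA.
Qed.

(* An occupied point is either the successor, in its block, of an occupied point
   or a head, below which everything is occupied; so a progression starting at
   the least free point meets no occupied point. *)
Lemma greedy_uniq m occ ls : 0 < m -> uniq occ ->
  (forall y, y \in occ ->
     (m <= y /\ y - m \in occ) \/ (forall z, z <= y -> z \in occ)) ->
  uniq (occ ++ flatten (greedy m occ ls)).
Proof.
move=> hm; elim: ls occ => [|l ls IH] occ huq hocc /=; first by rewrite cats0.
rewrite catA; apply: IH.
  rewrite cat_uniq huq nat_ap_uniq // andbT -all_predC; apply/allP => y /nat_apP[j _ ->] /=.
  elim: j => [|j IHj]; first by rewrite mul0n addn0 least_free_notin.
  apply/negP => /hocc[[_]|/(_ (least_free occ))].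
    by rewrite mulSn addnCA addKn (negPf IHj).
  by rewrite leq_addr (negPf (least_free_notin occ)) => /(_ isT).
move=> y; rewrite mem_cat => /orP[/hocc[[h1 h2]|h]|/nat_apP[[|j] hj ->]].
- by left; rewrite mem_cat h2.
- by right=> z hz; rewrite mem_cat h.
- right=> z; rewrite mul0n addn0 leq_eqVlt => /orP[/eqP->|/least_free_below h].
    by rewrite mem_cat; apply/orP; right; apply/nat_apP; exists 0; rewrite // addn0.
  by rewrite mem_cat h.
- left; split; first by nia.
  rewrite mem_cat; apply/orP; right; apply/nat_apP; exists j; first by lia.
  by nia.
Qed.

(** A head is the least free point when its block is placed, and covered points stay covered. *)
Lemma greedy_head_below m occ ls B : B \in greedy m occ ls ->
  exists x l, [/\ B = nat_ap m x l, l \in ls, x \notin occ &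
     forall z, z < x -> z \in occ ++ flatten (greedy m occ ls)].
Proof.
elim: ls occ => //= l ls IH occ; rewrite inE => /orP[/eqP->|/IH[x [l' [-> hl hx hz]]]].
  exists (least_free occ), l; split; rewrite ?inE ?eqxx ?least_free_notin //.
  by move=> z /least_free_below h; rewrite mem_cat h.
exists x, l'; split; rewrite ?inE ?hl ?orbT //.
  by move: hx; rewrite mem_cat negb_or => /andP[].
by move=> z /hz; rewrite catA.
Qed.

(** A least free point at or above [N] would mean that [occ] already covers all of [0, ..., N - 1],
    for which it is too small. *)
Lemma greedy_singletons m N occ s : uniq occ ->
  (forall y, y \in occ -> y < N) -> size occ + s <= N ->
  forall y, y \in flatten (greedy m occ (nseq s 1)) -> y < N.
Proof.
elim: s occ => //= s IH occ huq hN hs y.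
have hlt : least_free occ < N.
  rewrite ltnNge; apply/negP => hge.
  have : size (iota 0 N) <= size occ.
    apply: uniq_leq_size (iota_uniq _ _) _ => z; rewrite mem_iota /= => hz.
    by apply: least_free_below; lia.
  by rewrite size_iota; lia.
have hap : nat_ap m (least_free occ) 1 = [:: least_free occ].
  by rewrite /nat_ap /mkseq /= mul0n addn0.
rewrite mul0n addn0 hap inE => /orP[/eqP->//|]; apply: (IH _ _ _ _ y).
- by rewrite cats1 rcons_uniq least_free_notin.
- by move=> z; rewrite cats1 mem_rcons inE => /orP[/eqP->|/hN].
- by rewrite size_cat /=; lia.
Qed.

Lemma trailE ls : exists ls', ls = ls' ++ nseq (trail ls) 1.
Proof.
rewrite /trail; set s := find _ _.
have h : take s (rev ls) = nseq s 1.
  apply: (@eq_from_nth _ 0); rewrite size_take_min ?size_nseq.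
    by apply/minn_idPl; rewrite /s find_size.
  move=> j; rewrite leq_min => /andP[hj hj2].
  rewrite nth_take // nth_nseq hj.
  by have := before_find 0 hj; move/negbFE/eqP.
exists (rev (drop s (rev ls))).
by rewrite -{1}[ls]revK -{1}[rev ls](cat_take_drop s) h rev_cat rev_nseq.
Qed.

(** The placed points are distinct and [sumn ls] in number, so it is enough that none reaches
    [sumn ls]. A block that did would have to leave more free points in its gaps than [good] allows;
    the final singletons then fill the holes. *)
Lemma greedy_fills m M ls : 0 < m <= M -> good M ls ->
  perm_eq (flatten (greedy m [::] ls)) (iota 0 (sumn ls)).
Proof.
case/andP=> hm hmM hg; have hu := @greedy_uniq m [::] ls hm isT ltac:(by []).
rewrite /= in hu.
suff hN y : y \in flatten (greedy m [::] ls) -> y < sumn ls.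
  apply: uniq_perm; rewrite ?iota_uniq //.
  have hsub : {subset flatten (greedy m [::] ls) <= iota 0 (sumn ls)}.
    by move=> z /hN; rewrite mem_iota.
  by case: (uniq_min_size hu hsub); rewrite ?size_iota ?size_flatten_greedy.
have [A eA] := trailE ls.
set s := trail ls in eA.
have hsum : sumn ls = sumn A + s by rewrite {1}eA sumn_cat sumn_nseq mul1n.
have hgA l : l \in A -> (M - 1) * (l - 1) <= s.
  by move=> hl; move/allP: hg => /(_ l); rewrite {1}eA mem_cat hl => /(_ isT)/andP[].
rewrite {1}eA greedy_cat flatten_cat mem_cat /=.
set occ := flatten (greedy m [::] A).
have huA : uniq occ by have := @greedy_uniq m [::] A hm isT ltac:(by []).
have hocc z : z \in occ -> z < sumn ls.
  move=> hz; rewrite ltnNge; apply/negP => hge.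
  have [B hB hzB] := flattenP hz.
  have [x [l [eB hl _ hx]]] := greedy_head_below hB.
  rewrite eB in hzB; have /nat_apP[j hj ez] := hzB.
  (* The points left free by [A] below [sumn ls]. They lie strictly between the head [x] and [z],
     since everything below [x] is covered, so they all sit in gaps of [B]. *)
  pose ys := [seq y <- iota 0 (sumn ls) | y \notin occ].
  have hys : size ys <= j * (m - 1).
    apply: (@count_gaps m x) => //; first by rewrite filter_uniq // iota_uniq.
      move=> w; rewrite mem_filter mem_iota add0n => /andP[hw /= hwN].
      rewrite -ez (leq_trans hwN hge) andbT ltnNge; apply/negP.
      rewrite leq_eqVlt => /orP[/eqP ew|/hx hw2]; last first.
        by rewrite -[flatten _]/occ (negPf hw) in hw2.
      case/negP: hw; apply/flattenP; exists B => //; rewrite eB ew.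
      by apply/nat_apP; exists 0; [lia|rewrite addn0].
    move=> w; rewrite mem_filter => /andP[hw _]; apply: contra hw => /nat_apP[i hi ->].
    apply/flattenP; exists B => //; rewrite eB; apply/nat_apP; exists i => //; lia.
  (* The predecessor is what gives the contradiction: [z] is covered but lies outside the interval,
     so at least [s + 1] points of the interval are free. *)
  have hcnt : sumn ls <= size ys + (size occ).-1.
    have := count_predC (mem occ) (iota 0 (sumn ls)).
    rewrite size_iota => <-; rewrite addnC size_filter leq_add2l.
    rewrite -(size_rem hz) -size_filter; apply: uniq_leq_size.
      by rewrite filter_uniq // iota_uniq.
    move=> w; rewrite mem_filter mem_iota /= => /andP[h1 h2].
    rewrite rem_filter // mem_filter /= h1 andbT; lia.
  have hso : size occ = sumn A by rewrite size_flatten_greedy.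
  have hpos : 0 < size occ by case: (occ) hz.
  by have := hgA _ hl; nia.
case/orP=> [/hocc//|]; apply: greedy_singletons => //.
by rewrite size_flatten_greedy hsum.
Qed.

Lemma greedy_pairwise m occ ls : all (leq 1) ls ->
  pairwise (fun B C => head 0 B < head 0 C) (greedy m occ ls).
Proof.
elim: ls occ => //= l ls IH occ /andP[hl hls].
rewrite IH // andbT; apply/allP => C /greedy_head_below[x [l' [-> hl' hx _]]].
have hp : 0 < l' by have/allP/(_ l' hl') := hls.
case: l' hp {hl'} => // l' _; case: l hl hx => // l _ hx /=; rewrite !mul0n !addn0.
rewrite ltnNge; apply/negP; rewrite leq_eqVlt => /orP[/eqP e|/least_free_below h].
  by move: hx; rewrite e mem_cat inE mul0n addn0 eqxx orbT.
by move: hx; rewrite mem_cat h.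
Qed.

(** Once an initial interval of length [N] is full, the placement goes on as a translate by [N]; a
    general [occ] is carried for the induction. *)
Lemma greedy_shift m N occ occ' ls :
  (forall y, (y \in occ') = (y < N) || (N <= y) && (y - N \in occ)) ->
  greedy m occ' ls = [seq [seq N + y | y <- B] | B <- greedy m occ ls].
Proof.
elim: ls occ occ' => //= l ls IH occ occ' h.
have e : least_free occ' = N + least_free occ.
  apply: least_free_eq => [|z hz].
    by rewrite h addKn (negPf (least_free_notin occ)) andbF orbF; lia.
  rewrite h; case: ltnP => //= hN; apply: least_free_below; lia.
have eB : nat_ap m (least_free occ') l = [seq N + y | y <- nat_ap m (least_free occ) l].
  by rewrite e -map_comp; apply: eq_map => j /=; rewrite addnA.
rewrite -eB; congr cons; apply: IH => y.
rewrite !mem_cat h eB; case: (ltnP y N) => hy //=; congr orb.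
apply/mapP/idP => [[x hx ->]|hx]; first by rewrite addKn.
by exists (y - N) => //; lia.
Qed.

(** * The final run of 1s in a list of lengths *)

Lemma trail_cat_cons ls1 l ls2 : l != 1 -> all (pred1 1) ls2 ->
  trail (ls1 ++ l :: ls2) = size ls2.
Proof.
move=> hl h2; rewrite /trail rev_cat rev_cons cat_rcons find_cat /= hl addn0 size_rev.
suff -> : has (predC1 1) (rev ls2) = false by [].
by rewrite has_rev; apply/negbTE; rewrite -all_predC; apply: sub_all h2 => x /= /eqP->.
Qed.

Lemma trail_rcons ls l : trail (rcons ls l) = if l == 1 then (trail ls).+1 else 0.
Proof. by rewrite /trail rev_rcons /=; case: eqP. Qed.

Lemma trail_cat ls1 ls2 : has (predC1 1) ls2 -> trail (ls1 ++ ls2) = trail ls2.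
Proof. by move=> h; rewrite /trail rev_cat find_cat has_rev h. Qed.

Lemma split_last (T : Type) (p : pred T) (s : seq T) : has p s ->
  exists s1 x s2, [/\ s = s1 ++ x :: s2, p x & all (predC p) s2].
Proof.
elim: s => //= x s IH; have [hs _|hs] := boolP (has p s).
  have [s1 [y [s2 [-> py h2]]]] := IH hs.
  by exists (x :: s1), y, s2.
by rewrite orbF => px; exists [::], x, s; split; rewrite // all_predC.
Qed.

(** The list starts with an entry other than 1, so every 1 belongs to the run that follows some such
    entry. Each of these runs has length at most [s], and the last one has length [trail ls]. *)
Lemma count_le_trail s ls : head 1 ls != 1 ->
  (forall j, j <= size ls -> trail (take j ls) <= s) ->
  count_mem 1 ls + s <= s * count (predC1 1) ls + trail ls.
Proof.
elim/last_ind: ls => // ls l IH hh hs.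
rewrite trail_rcons -cats1 !count_cat /= !addn0.
have hs' j : j <= size ls -> trail (take j ls) <= s.
  move=> hj; have := hs j; rewrite size_rcons -cats1 takel_cat //; apply; lia.
have ht : trail ls <= s by have := hs' _ (leqnn _); rewrite take_size.
case: ls IH hh hs' ht {hs} => [_ /= hl _ _|a ls IH hh hs' ht].
  by rewrite (negPf hl) /=; lia.
by have := IH hh hs'; case: (l == 1) => /=; lia.
Qed.

Lemma find_eq (T : Type) (x0 : T) (p : pred T) (s : seq T) i : i < size s ->
  p (nth x0 s i) -> (forall j, j < i -> ~~ p (nth x0 s j)) -> find p s = i.
Proof.
move=> hi hp hj; case: (ltngtP (find p s) i) => // h.
  have := hj _ h; rewrite nth_find // has_find; exact: ltn_trans h hi.
by have := before_find x0 h; rewrite hp.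
Qed.

(** * Sorting by an injective key *)

Lemma uniq_pairwise_lt (T : eqType) (f : T -> nat) (s : seq T) :
  pairwise (fun x y => f x < f y) s -> uniq (map f s).
Proof.
move=> h; apply: (sorted_uniq ltn_trans ltnn).
by apply: pairwise_sorted; rewrite pairwise_map.
Qed.

Lemma pairwise_lt_inj (T : eqType) (f : T -> nat) (s : seq T) :
  pairwise (fun x y => f x < f y) s -> {in s &, injective f}.
Proof.
move/uniq_pairwise_lt; elim: s => //= a s IH /andP[ha /IH hs] x y.
rewrite !inE => /orP[/eqP->|hx] /orP[/eqP->|hy] e //; last exact: hs.
  by case/mapP: ha; exists y.
by case/mapP: ha; exists x.
Qed.

Lemma sort_pairwise_lt (T : eqType) (f : T -> nat) (s s' : seq T) :
  pairwise (fun x y => f x < f y) s -> perm_eq s s' ->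
  sort (fun x y => f x <= f y) s' = s.
Proof.
move=> hs hp; apply: (@sorted_eq_in _ (fun x y => f x <= f y)).
- by move=> y x z _ _ _; apply: leq_trans.
- move=> x y; rewrite !mem_sort -!(perm_mem hp) => hx hy.
  by rewrite -eqn_leq => /eqP; apply: (pairwise_lt_inj hs).
- by apply: sort_sorted => x y; apply: leq_total.
- by apply: pairwise_sorted; apply: sub_pairwise hs => x y; apply: ltnW.
- by rewrite perm_sort perm_sym.
Qed.

Lemma pairwise_lt_sort (T : eqType) (f : T -> nat) (s : seq T) :
  uniq s -> {in s &, injective f} ->
  pairwise (fun x y => f x < f y) (sort (fun x y => f x <= f y) s).
Proof.
move=> hu hi; rewrite -(pairwise_map f ltn) -sorted_pairwise; last exact: ltn_trans.
rewrite ltn_sorted_uniq_leq map_inj_in_uniq ?sort_uniq ?hu /=; last first.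
  by move=> x y; rewrite !mem_sort; apply: hi.
rewrite sorted_map; apply: sort_sorted => x y; exact: leq_total.
Qed.

(** * Blocks on the cycle *)

Local Open Scope ring_scope.

Lemma pos_lt n (h x : 'Z_n) : (1 < n)%N -> (pos h x < n)%N.
Proof. by move=> hn; rewrite -[X in (_ < X)%N](Zp_cast hn) /pos ltn_ord. Qed.

Lemma posK n (h x : 'Z_n) : h + (pos h x)%:R = x.
Proof. by rewrite /pos natr_Zp addrC subrK. Qed.

Lemma pos_nat n (h : 'Z_n) p : (p < n)%N -> (1 < n)%N -> pos h (h + p%:R) = p.
Proof. by move=> hp hn; rewrite /pos addrC addKr -[RHS](modn_small hp) -val_Zp_nat. Qed.

Lemma pos_inj n (h : 'Z_n) : injective (pos h).
Proof. by move=> x y e; rewrite -(posK h x) e posK. Qed.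

Lemma pos_self n (h : 'Z_n) : (1 < n)%N -> pos h h = 0%N.
Proof. by move=> hn; rewrite -{2}[h]addr0 (pos_nat h (p := 0)) //; lia. Qed.

Lemma pos_shift n (h h' x : 'Z_n) : (1 < n)%N ->
  pos h' x = (if pos h h' <= pos h x then pos h x - pos h h'
              else pos h x + n - pos h h')%N.
Proof.
move=> hn; have := pos_lt h h' hn; have := pos_lt h x hn.
set p := pos h h'; set q := pos h x => hq hp.
have eh' : h' = h + p%:R by rewrite posK.
have ex : x = h + q%:R by rewrite posK.
case: leqP => hpq.
  have -> : x = h' + (q - p)%:R by rewrite ex eh' -addrA -natrD subnKC.
  by rewrite pos_nat //; lia.
have -> : x = h' + (q + n - p)%:R.
  rewrite ex eh' -addrA -natrD subnKC; last by lia.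
  by rewrite natrD pchar_Zp // addr0.
by rewrite pos_nat //; lia.
Qed.

Lemma ap_seqP n m (x : 'Z_n) l y :
  reflect (exists2 j, (j < l)%N & y = x + (j * m)%:R) (y \in ap_seq m x l).
Proof.
apply: (iffP mapP) => [[j]|[j hj ->]]; first by rewrite mem_iota /= => h ->; exists j.
by exists j => //; rewrite mem_iota.
Qed.

Definition head_pos n (h : 'Z_n) (B : seq 'Z_n) : nat := pos h (head 0 B).

Lemma partition_inj n m (pi : {fset seq 'Z_n}) B C x : is_ap_partition m pi ->
  B \in pi -> C \in pi -> x \in B -> x \in C -> B = C.
Proof.
by case=> _ hp hB hC hxB hxC; have [D [_ hD]] := hp x; rewrite -(hD B) // (hD C).
Qed.

Lemma block_head n m (pi : {fset seq 'Z_n}) B : is_ap_partition m pi ->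
  B \in pi -> head 0 B \in B.
Proof. by case=> h _ /h[]; case: B => //= a B _ _ _; rewrite inE eqxx. Qed.

Lemma mem_ordered n (h : 'Z_n) (pi : {fset seq 'Z_n}) B :
  (B \in ordered_blocks h pi) = (B \in pi).
Proof. by rewrite mem_sort. Qed.

Lemma ordered_blocks_eq n (h : 'Z_n) (pi : {fset seq 'Z_n}) s :
  pairwise (fun B C => head_pos h B < head_pos h C)%N s ->
  perm_eq s (enum_fset pi) -> ordered_blocks h pi = s.
Proof. exact: sort_pairwise_lt. Qed.

Lemma ordered_pairwise n m (h : 'Z_n) (pi : {fset seq 'Z_n}) : is_ap_partition m pi ->
  pairwise (fun B C => head_pos h B < head_pos h C)%N (ordered_blocks h pi).
Proof.
move=> hpi; apply: (pairwise_lt_sort (f := head_pos h)).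
  exact: fset_uniq.
move=> B C hB hC /pos_inj e.
by apply: (partition_inj hpi hB hC (block_head hpi hB)); rewrite e (block_head hpi).
Qed.

Lemma head_pos_shift n (h h' : 'Z_n) B : (1 < n)%N ->
  head_pos h' B = (if pos h h' <= head_pos h B then head_pos h B - pos h h'
                   else head_pos h B + n - pos h h')%N.
Proof. exact: pos_shift. Qed.

Lemma head_pos_lt n (h : 'Z_n) B : (1 < n)%N -> (head_pos h B < n)%N.
Proof. exact: pos_lt. Qed.

Lemma head_posK n (h : 'Z_n) B : h + (head_pos h B)%:R = head 0 B.
Proof. exact: posK. Qed.

(** Seen from the [j]-th head, the positions of the blocks from there on drop by a constant, and
    those of the earlier blocks move behind them by a turn of [n]. *)
Lemma ordered_blocks_rot n m (h : 'Z_n) (pi : {fset seq 'Z_n}) j : (1 < n)%N ->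
  is_ap_partition m pi -> (j < size (ordered_blocks h pi))%N ->
  ordered_blocks (head 0%R (nth [::] (ordered_blocks h pi) j)) pi =
  rot j (ordered_blocks h pi).
Proof.
move=> hn hpi hj; set s := ordered_blocks h pi in hj *; set h' := head _ _.
apply: ordered_blocks_eq; last by rewrite perm_rot perm_sort.
have := ordered_pairwise h hpi; rewrite -/s -{1}(cat_take_drop j s) /rot !pairwise_cat.
have es : drop j s = nth [::] s j :: drop j.+1 s by rewrite -drop_nth.
case/and3P=> /allrelP h1 h2 h3.
have ht B : B \in take j s -> (head_pos h B < pos h h')%N.
  by move=> hB; apply: h1 => //; rewrite es inE eqxx.
have hd B : B \in drop j s -> (pos h h' <= head_pos h B)%N.
  move: h3; rewrite es pairwise_cons => /andP[/allP h3 _].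
  by rewrite inE => /orP[/eqP->//|/h3]; apply: ltnW.
apply/and3P; split.
- apply/allrelP => B C /hd hB /ht hC; rewrite !(head_pos_shift h h') // hB (ltn_geF hC).
  have := head_pos_lt h B hn; have := pos_lt h h' hn; lia.
- apply: (sub_in_pairwise (P := mem (drop j s)) _ _ h3); last exact/allP.
  move=> B C hB hC; rewrite !(head_pos_shift h h') // (hd B) // (hd C) //.
  have := hd _ hB; have := hd _ hC; lia.
- apply: (sub_in_pairwise (P := mem (take j s)) _ _ h2); last exact/allP.
  move=> B C hB hC; rewrite !(head_pos_shift h h') // (ltn_geF (ht B hB)) (ltn_geF (ht C hC)).
  have := ht _ hB; have := ht _ hC.
  have := pos_lt h h' hn; lia.
Qed.

Lemma size_block_gt0 n m (pi : {fset seq 'Z_n}) B : is_ap_partition m pi ->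
  B \in pi -> (0 < size B)%N.
Proof. by case=> h _ /h[]. Qed.

(** Together with [h], this is all that [separation_from] reads from the partition. *)
Definition lens n (h : 'Z_n) (pi : {fset seq 'Z_n}) : seq nat :=
  [seq size C | C <- ordered_blocks h pi].

(** The star of [h] is the head of the last non-singleton block [Bs], and the singletons met from
    there to [h] are the blocks of [S] that follow [Bs]. *)
Lemma gap_trail n m (h : 'Z_n) (pi : {fset seq 'Z_n}) : (1 < n)%N ->
  is_ap_partition m pi -> has (predC1 1%N) (lens h pi) ->
  gap pi h = trail (lens h pi).
Proof.
move=> hn hpi; rewrite /lens has_map => /split_last[A [Bs [S [eobs /= hBs hS]]]].
rewrite eobs map_cat /= trail_cat_cons //; last first.
  by rewrite all_map; apply: sub_all hS => B /=; rewrite negbK.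
rewrite size_map; have hpw := ordered_pairwise h hpi.
have hm B : (B \in pi) = (B \in A) || (B == Bs) || (B \in S).
  by rewrite -(mem_ordered h) eobs mem_cat inE orbA.
move: hpw; rewrite eobs pairwise_cat pairwise_cons => /and3P[/allrelP hA _ /andP[/allP hSp hSS]].
set p := head_pos h Bs; have hp : (p < n)%N := head_pos_lt _ _ hn.
have hBin : Bs \in pi by rewrite hm eqxx orbT.
have hBs1 : (1 < size Bs)%N.
  by have := size_block_gt0 hpi hBin; move: hBs; case: (size Bs) => [|[]].
have hsub j : (j <= n)%N -> h - j%:R = h + (n - j)%:R.
  by move=> hj; rewrite natrB // pchar_Zp // sub0r.
(* This is a full turn when [Bs] has its head at [h], that is [p = 0]. The index found is one less,
   as the search starts at distance 1. *)
have hsd : star_dist pi h = (n - p)%N.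
  rewrite /star_dist (@find_eq _ 0%N _ _ (n - p).-1) ?size_iota.
  - lia.
  - lia.
  - rewrite nth_iota; last by lia.
    have -> : (1 + (n - p).-1 = n - p)%N by lia.
    apply/hasP; exists Bs => //; rewrite hBs1 andbT hsub; last by lia.
    by rewrite subKn ?head_posK // ltnW.
  - move=> j hj; rewrite nth_iota; last by lia.
    apply/negP => /hasP[C hC /andP[/eqP eC hC1]].
    have epos : head_pos h C = (n - (1 + j))%N.
      by rewrite /head_pos eC hsub ?pos_nat //; lia.
    have hCpi : C \in pi by [].
    move: hCpi; rewrite hm => /orP[/orP[hCA|/eqP eCB]|hCS].
    + have := hA C Bs hCA; rewrite inE eqxx => /(_ isT); rewrite -/p epos; lia.
    + by move: epos; rewrite eCB -/p; lia.
    + by have /allP/(_ C hCS) /= := hS; rewrite negbK => /eqP e1; rewrite e1 in hC1.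
rewrite /gap /star hsd -size_filter -(size_map (head 0) S).
have -> : h - (n - p)%:R = h + p%:R by rewrite hsub ?subKn // ?leq_subr // ltnW.
apply: perm_size; apply: uniq_perm.
- rewrite filter_uniq // map_inj_in_uniq ?iota_uniq // => a b.
  rewrite !mem_iota /= => ha hb; rewrite -!addrA -!natrD => e.
  have : pos h (h + (p + a)%:R) = pos h (h + (p + b)%:R) by rewrite e.
  rewrite !pos_nat //; lia.
- have := @uniq_pairwise_lt _ (head_pos h) S hSS.
  by rewrite (map_comp (pos h)); apply: map_uniq.
move=> x; rewrite mem_filter; apply/andP/mapP => [[hx /mapP[j]]|[C hC ->]].
  rewrite mem_iota /= => hj ex.
  have hpx : head_pos h [:: x] = (p + j)%N by rewrite /head_pos /= ex -addrA -natrD pos_nat //; lia.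
  move: (hx); rewrite hm => /orP[/orP[hxA|/eqP exB]|hxS].
  - have := hA _ Bs hxA; rewrite inE eqxx => /(_ isT); rewrite -/p hpx; lia.
  - by move: hBs1; rewrite -exB.
  - by exists [:: x].
have hC1 : size C = 1%N by have /allP/(_ C hC) /= := hS; rewrite negbK => /eqP.
have hCpi : C \in pi by rewrite hm hC orbT.
have hlt := hSp _ hC; rewrite -/p in hlt.
split; first by case: C hC1 hCpi {hC hlt} => // a [].
apply/mapP; exists (head_pos h C - p)%N.
  by rewrite mem_iota /=; have := head_pos_lt h C hn; lia.
by rewrite -addrA -natrD subnKC ?head_posK // ltnW.
Qed.

(** * Partitions as greedy placements *)

Lemma first_free_eq n (h : 'Z_n) occ c : (1 < n)%N -> c \notin occ ->
  (forall x, (pos h x < pos h c)%N -> x \in occ) -> first_free h occ = c.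
Proof.
move=> hn hc hx; rewrite /first_free.
have hp := pos_lt h c hn; set p := pos h c in hp hx *.
have -> : iota 0 n = iota 0 (p + (n - p).-1.+1) by congr iota; lia.
rewrite iotaD map_cat filter_cat /= add0n posK hc.
rewrite (_ : filter _ _ = [::]) //.
apply/eqP; rewrite -size_eq0 size_filter eqn0Ngt -has_count -all_predC.
apply/allP => x /mapP[j]; rewrite mem_iota /= => hj ->.
by rewrite negbK hx // pos_nat //; lia.
Qed.

Definition embed n (h : 'Z_n) (p : nat) : 'Z_n := h + p%:R.

Lemma embed_inj n (h : 'Z_n) p q : (1 < n)%N -> (p < n)%N -> (q < n)%N ->
  embed h p = embed h q -> p = q.
Proof. by move=> hn hp hq e; rewrite -(pos_nat h hp) // -(pos_nat h hq) // -/(embed h p) e. Qed.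

Lemma map_nat_ap n (h : 'Z_n) m x l : map (embed h) (nat_ap m x l) = ap_seq m (embed h x) l.
Proof. by rewrite -map_comp; apply: eq_map => j /=; rewrite /embed natrD addrA. Qed.

(** As long as all positions stay below [n], [embed h] is injective on them, so the placement on the
    cycle copies the one in the naturals. *)
Lemma place_blocks_greedy n m (h : 'Z_n) occ ls : (1 < n)%N -> all (leq 1) ls ->
  (forall y, y \in occ ++ flatten (greedy m occ ls) -> y < n)%N ->
  place_blocks m h (map (embed h) occ) ls =
  [seq map (embed h) B | B <- greedy m occ ls].
Proof.
move=> hn; elim: ls occ => //= l ls IH occ /andP[hl hls] hy.
have hf : (least_free occ < n)%N.
  apply: hy; rewrite !mem_cat; apply/orP; right; apply/orP; left.
  by apply/nat_apP; exists 0%N; rewrite // addn0.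
have -> : first_free h (map (embed h) occ) = embed h (least_free occ).
  apply: first_free_eq => //.
    apply/mapP => -[q hq /embed_inj e]; have := least_free_notin occ.
    by rewrite e ?hq // hy // mem_cat hq.
  move=> x; rewrite /embed pos_nat // => /least_free_below hx.
  by rewrite -(posK h x) -/(embed h (pos h x)) map_f.
rewrite map_nat_ap; congr cons; rewrite -map_nat_ap -map_cat; apply: IH => //.
by move=> y; rewrite -catA; apply: hy.
Qed.

Lemma uniq_flatten_inj (T : eqType) (ss : seq (seq T)) s t x : uniq (flatten ss) ->
  s \in ss -> t \in ss -> x \in s -> x \in t -> s = t.
Proof.
elim: ss => //= a ss IH; rewrite cat_uniq => /and3P[_ /hasPn hd hu].
rewrite !inE => /orP[/eqP->|hs] /orP[/eqP->|ht] // hx hy; last exact: IH.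
  by have := hd x; rewrite hx => /(_ ltac:(by apply/flattenP; exists t)).
by have := hd x; rewrite hy => /(_ ltac:(by apply/flattenP; exists s)).
Qed.

Lemma good_gt0 M ls : good M ls -> all (leq 1) ls.
Proof. by apply: sub_all => l /andP[]. Qed.

Lemma place_blocks_good n m M (h : 'Z_n) ls : (1 < n)%N -> (0 < m <= M)%N ->
  good M ls -> sumn ls = n ->
  place_blocks m h [::] ls = [seq map (embed h) B | B <- greedy m [::] ls].
Proof.
move=> hn hm hg hs; apply: (@place_blocks_greedy _ _ _ [::]) => //.
  exact: good_gt0 hg.
by move=> y; rewrite /= (perm_mem (greedy_fills hm hg)) mem_iota hs.
Qed.

(** The first list fills exactly an interval of length [sumn ls1], so the second is placed as if it
    started afresh just after it. This is used to compare two starts. *)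
Lemma place_blocks_cat n m M (h : 'Z_n) ls1 ls2 : (1 < n)%N -> (0 < m <= M)%N ->
  good M ls1 -> good M ls2 -> (sumn ls1 + sumn ls2 = n)%N ->
  place_blocks m h [::] (ls1 ++ ls2) =
  [seq map (embed h) B | B <- greedy m [::] ls1] ++
  [seq map (embed (embed h (sumn ls1))) B | B <- greedy m [::] ls2].
Proof.
move=> hn hm hg1 hg2 hs.
have e1 := perm_mem (greedy_fills hm hg1); have e2 := perm_mem (greedy_fills hm hg2).
have eg : greedy m [::] (ls1 ++ ls2) = greedy m [::] ls1 ++
    [seq [seq (sumn ls1 + y)%N | y <- B] | B <- greedy m [::] ls2].
  rewrite greedy_cat; congr cat; apply: greedy_shift => y.
  by rewrite /= e1 mem_iota andbF orbF.
rewrite (@place_blocks_greedy _ _ _ [::]) //.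
- rewrite eg map_cat; congr cat; rewrite -map_comp; apply: eq_map => B /=.
  by rewrite -map_comp; apply: eq_map => y; rewrite /embed /= natrD addrA.
- by rewrite all_cat (good_gt0 hg1) (good_gt0 hg2).
- move=> y; rewrite /= eg flatten_cat mem_cat e1 mem_iota -map_flatten.
  case/orP=> [|/mapP[z]]; first by lia.
  by rewrite e2 mem_iota => hz ->; lia.
Qed.

(* The trailing singletons of the order starting at [h] are too many to fit in
   the gaps of a block that would go past [h]. *)
Lemma block_no_wrap n m M (h : 'Z_n) (pi : {fset seq 'Z_n}) B j : (1 < n)%N ->
  (0 < m <= M)%N -> is_ap_partition m pi -> is_head pi h ->
  has (predC1 1%N) (lens h pi) -> good M (lens h pi) ->
  B \in pi -> (j < size B)%N -> (head_pos h B + j * m < n)%N.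
Proof.
move=> hn /andP[hm hmM] hpi /hasP[D hD /eqP eD].
rewrite /lens has_map => /split_last[A [Bs [S [eobs /= hBs hS]]]] hg hB.
have hpw := ordered_pairwise h hpi.
have hin C : (C \in pi) = (C \in A) || (C == Bs) || (C \in S).
  by rewrite -(mem_ordered h) eobs mem_cat inE orbA.
have ht : trail (lens h pi) = size S.
  rewrite /lens eobs map_cat /= trail_cat_cons ?size_map //.
  by rewrite all_map; apply: sub_all hS => C /=; rewrite negbK.
have [hB0 hBu eB] := (proj1 hpi) _ hB.
have elt i : (i < size B)%N -> h + (head_pos h B + i * m)%:R \in B.
  move=> hi; suff : h + (head_pos h B + i * m)%:R \in ap_seq m (head 0 B) (size B).
    by rewrite -eB.
  by apply/ap_seqP; exists i => //; rewrite natrD addrA head_posK.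
have nthB i : (i < size B)%N -> nth 0 B i = head 0 B + (i * m)%:R.
  by move=> hi; rewrite {1}eB nth_mkseq.
elim: j => [_|j IH hj]; first by rewrite addn0 head_pos_lt.
have {}IH := IH (ltnW hj).
rewrite ltnNge; apply/negP => hge.
(* Landing exactly on [h] would make [B] the block headed by [h], which would then contain [h]
   twice. *)
have hneq : (head_pos h B + j.+1 * m)%N <> n.
  move=> e; have hhB := elt _ hj; rewrite e pchar_Zp // addr0 in hhB.
  have eBD : B = D.
    by apply: (partition_inj hpi hB hD hhB); rewrite -eD (block_head hpi).
  have e0 : head_pos h B = 0%N by rewrite /head_pos eBD eD pos_self.
  have h0 : nth 0 B 0 = nth 0 B j.+1.
    rewrite !nthB // mul0n; congr (_ + _).
    by move: e; rewrite e0 add0n => ->; rewrite pchar_Zp.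
  by have := nth_uniq 0 hB0 hj hBu; rewrite h0 eqxx.
move: hpw; rewrite eobs pairwise_cat pairwise_cons.
case/and3P=> /allrelP hA _ /andP[/allP hSp hSS].
have hlt C : C \in S -> (head_pos h B < head_pos h C)%N.
  move=> hC; move: (hB); rewrite hin => /orP[/orP[hBA|/eqP->]|hBS].
  - by apply: hA; rewrite // inE hC orbT.
  - exact: hSp.
  - by have /allP/(_ B hBS) /= := hS; rewrite negbK => /eqP; lia.
have hCpi C : C \in S -> C \in pi by move=> hC; rewrite hin hC orbT.
(* Position [n] stands for [h] after a full turn. The step from term [j] to term [j.+1] jumps over
   it, so [h] and all the singletons of [S] lie in gaps of [B]: one point too many for [good]. *)
have : (size (n :: map (head_pos h) S) <= j.+1 * (m - 1))%N.
  apply: (count_gaps (m := m) (x := head_pos h B)) => //.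
  - rewrite /= uniq_pairwise_lt // andbT; apply/mapP => -[C _ e].
    by have := head_pos_lt h C hn; lia.
  - move=> y; rewrite inE => /orP[/eqP->|/mapP[C hC ->]].
      by rewrite head_pos_lt //; lia.
    by rewrite hlt //; have := head_pos_lt h C hn; lia.
  move=> y; rewrite inE => /orP[/eqP->|/mapP[C hC ->]]; apply/nat_apP => -[i hi e].
    nia.
  have hiB := ltn_trans hi hj.
  have := elt _ hiB; rewrite -e head_posK => hCB.
  have eCB := partition_inj hpi (hCpi _ hC) hB (block_head hpi (hCpi _ hC)) hCB.
  by have := hlt _ hC; rewrite eCB ltnn.
rewrite /= size_map => hle.
have /andP[_] : (0 < size B)%N && ((M - 1) * (size B - 1) <= trail (lens h pi))%N.
  by apply: (allP hg); rewrite map_f // mem_ordered.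
rewrite ht leqNgt => /negP[]; apply: leq_trans hle _.
rewrite mulnC leq_mul ?leq_sub2r //.
by rewrite -ltnS subn1 prednK // (leq_trans _ hj).
Qed.

(** As no block passes [h], a point never precedes the head of its own block. Hence every point
    before the head of [C] lies in a block listed before [C], and that head is the first free
    point. *)
Lemma ordered_blocks_place n m M (h : 'Z_n) (pi : {fset seq 'Z_n}) : (1 < n)%N ->
  (0 < m <= M)%N -> is_ap_partition m pi -> is_head pi h ->
  has (predC1 1%N) (lens h pi) -> good M (lens h pi) ->
  ordered_blocks h pi = place_blocks m h [::] (lens h pi).
Proof.
move=> hn hm hpi hh hns hg.
have hpw := ordered_pairwise h hpi.
have hin B := mem_ordered h pi B.
(* Generalised to an arbitrary prefix [s1] of blocks already placed. *)
suff H s1 s2 : ordered_blocks h pi = s1 ++ s2 ->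
    place_blocks m h (flatten s1) (map size s2) = s2 by rewrite /lens (H [::]).
elim: s2 s1 => //= C s2 IH s1 es.
have hC : C \in pi by rewrite -hin es mem_cat inE eqxx orbT.
have hs1 B : B \in s1 -> B \in pi by move=> hB; rewrite -hin es mem_cat hB.
move: (hpw); rewrite es pairwise_cat pairwise_cons.
case/and3P=> /allrelP hA _ /andP[/allP hSp _].
have -> : first_free h (flatten s1) = head 0 C.
  apply: first_free_eq => //.
    apply/flattenP => -[B hB hCB].
    have eBC := partition_inj hpi (hs1 _ hB) hC hCB (block_head hpi hC).
    by have := hA B C hB; rewrite inE eqxx eBC ltnn => /(_ isT).
  move=> x hx; have [B [[hB hxB] _]] := (proj2 hpi) x.
  apply/flattenP; exists B => //.
  have [_ _ eB] := (proj1 hpi) _ hB.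
  have hle : (head_pos h B <= pos h x)%N.
    have /ap_seqP[j hj ->] : x \in ap_seq m (head 0 B) (size B) by rewrite -eB.
    rewrite -(head_posK h B) -addrA -natrD pos_nat ?leq_addr //.
    exact: (block_no_wrap hn hm hpi hh hns hg).
  have hlt := leq_ltn_trans hle hx.
  move: (hB); rewrite -hin es mem_cat inE => /orP[//|/orP[/eqP e|hB2]].
    by move: hlt; rewrite e /head_pos ltnn.
  by have := hSp _ hB2; rewrite ltnNge /head_pos (ltnW hlt).
have [_ _ eC] := (proj1 hpi) _ hC.
rewrite -eC; congr cons.
have := IH (rcons s1 C); rewrite flatten_rcons; apply.
by rewrite es cat_rcons.
Qed.

(** The greedy blocks partition the positions below [n], which [embed h] carries bijectively onto
    the cycle. Heads come out in increasing order, so sorting the blocks gives back the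
    placement. *)
Lemma place_blocks_partition n m M (h : 'Z_n) ls : (1 < n)%N -> (0 < m <= M)%N ->
  good M ls -> sumn ls = n ->
  let pi := [fset B in place_blocks m h [::] ls]%fset in
  is_ap_partition m pi /\ ordered_blocks h pi = place_blocks m h [::] ls.
Proof.
move=> hn hm hg hs; have eQ := place_blocks_good h hn hm hg hs.
have hperm := greedy_fills hm hg; rewrite hs in hperm.
set Q := place_blocks _ _ _ _ in eQ *; move=> pi.
have hm0 : (0 < m)%N by case/andP: hm.
have hgt := good_gt0 hg.
have hu : uniq (flatten (greedy m [::] ls)) by rewrite (perm_uniq hperm) iota_uniq.
have hltn B y : B \in greedy m [::] ls -> y \in B -> (y < n)%N.
  move=> hB hy; suff: y \in iota 0 n by rewrite mem_iota.
  by rewrite -(perm_mem hperm); apply/flattenP; exists B.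
have hin B : (B \in pi) = (B \in Q) by rewrite in_fset.
have hpw : pairwise (fun B C => head_pos h B < head_pos h C)%N Q.
  rewrite eQ pairwise_map.
  apply: (sub_in_pairwise (P := mem (greedy m [::] ls)) _ _ (greedy_pairwise m [::] hgt)).
    have hhead B : B \in greedy m [::] ls -> head_pos h (map (embed h) B) = head 0%N B.
      move=> hB; have [x [l [eB hl _ _]]] := greedy_head_below hB.
      have hxB : x \in B.
        rewrite eB; apply/nat_apP; exists 0%N; rewrite ?addn0 //.
        exact: (allP hgt).
      rewrite eB; have := allP hgt _ hl; case: l {hl eB} => //= l _.
      by rewrite /head_pos /= /embed mul0n addn0 pos_nat // (hltn B).
    by move=> B C hB hC /=; rewrite !hhead.
  exact/allP.
split; last first.
  apply: ordered_blocks_eq => //; apply: uniq_perm; rewrite ?fset_uniq //.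
  by have := uniq_pairwise_lt hpw; apply: map_uniq.
split=> [B|x].
  rewrite hin eQ => /mapP[C hC ->].
  have [x [l [eC hl _ _]]] := greedy_head_below hC.
  have l0 := allP hgt _ hl.
  split.
  - by rewrite size_map eC size_nat_ap.
  - rewrite map_inj_in_uniq; first by rewrite eC nat_ap_uniq.
    by move=> y z hy hz; apply: embed_inj => //; apply: (hltn C).
  - rewrite eC map_nat_ap size_mkseq; congr ap_seq.
    by case: l l0 {hl eC} => //= l _; rewrite addr0.
have : pos h x \in flatten (greedy m [::] ls).
  by rewrite (perm_mem hperm) mem_iota pos_lt.
case/flattenP=> C hC hx; exists (map (embed h) C); split.
  by split; [rewrite hin eQ map_f | have := map_f (embed h) hx; rewrite /embed posK].
move=> D [+ hxD]; rewrite hin eQ => /mapP[E hE eD]; rewrite eD; congr map.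
apply: (uniq_flatten_inj hu hC hE hx).
move: hxD; rewrite eD => /mapP[q hq ex].
by rewrite ex pos_nat // (hltn E).
Qed.

(** * Lists of lengths and starts *)

Lemma uniq_flatten (T : eqType) (ss : seq (seq T)) : uniq ss ->
  (forall s, s \in ss -> uniq s) ->
  (forall s t x, s \in ss -> t \in ss -> x \in s -> x \in t -> s = t) ->
  uniq (flatten ss).
Proof.
elim: ss => //= s ss IH /andP[hs hss] hu hd.
rewrite cat_uniq hu ?inE ?eqxx //=; apply/andP; split; last first.
  apply: IH => // [t ht|t t' x ht ht']; first by apply: hu; rewrite inE ht orbT.
  by apply: hd; rewrite inE ?ht ?ht' orbT.
apply/hasPn => x /flattenP[t ht hx]; apply/negP => hxs.
by case/negP: hs; rewrite (hd s t x) ?inE ?eqxx ?ht ?orbT.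
Qed.

Lemma sumn_lens n m (h : 'Z_n) (pi : {fset seq 'Z_n}) : (1 < n)%N ->
  is_ap_partition m pi -> sumn (lens h pi) = n.
Proof.
move=> hn hpi; rewrite /lens -[[seq size C | C <- _]]/(shape _) -size_flatten.
have hu : uniq (flatten (ordered_blocks h pi)).
  apply: uniq_flatten => [|B|B C x].
  - by rewrite sort_uniq fset_uniq.
  - by rewrite mem_ordered => /(proj1 hpi)[].
  - by rewrite !mem_ordered; apply: (partition_inj hpi).
have -> : size (flatten (ordered_blocks h pi)) = size (enum 'Z_n).
  apply/perm_size/uniq_perm; rewrite ?enum_uniq // => x.
  rewrite mem_enum inE; have [B [[hB hx] _]] := (proj2 hpi) x.
  by apply/flattenP; exists B; rewrite ?mem_ordered.
by rewrite -cardE card_ord Zp_cast.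
Qed.

Lemma nblocks_lens n (h : 'Z_n) (pi : {fset seq 'Z_n}) l :
  nblocks pi l = count_mem l (lens h pi).
Proof.
rewrite /nblocks /lens count_map.
by have /permP -> : perm_eq (enum_fset pi) (ordered_blocks h pi) by rewrite perm_sym perm_sort.
Qed.

Lemma lens_rot n m (h : 'Z_n) (pi : {fset seq 'Z_n}) j : (1 < n)%N ->
  is_ap_partition m pi -> (j < size (lens h pi))%N ->
  lens (head 0 (nth [::] (ordered_blocks h pi) j)) pi = rot j (lens h pi).
Proof.
by rewrite size_map => hn hpi hj; rewrite /lens (ordered_blocks_rot hn hpi hj) map_rot.
Qed.

Lemma is_headP n m (h x : 'Z_n) (pi : {fset seq 'Z_n}) : is_ap_partition m pi ->
  reflect (exists2 j, (j < size (lens h pi))%N &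
             x = head 0 (nth [::] (ordered_blocks h pi) j))
          (is_head pi x).
Proof.
move=> hpi; rewrite size_map; apply: (iffP hasP) => [[B hB /eqP e]|[j hj e]].
  have hB' : B \in ordered_blocks h pi by rewrite mem_ordered.
  by exists (index B (ordered_blocks h pi)); rewrite ?index_mem // nth_index.
exists (nth [::] (ordered_blocks h pi) j); last by rewrite e.
by have := mem_nth [::] hj; rewrite mem_ordered.
Qed.

(** The gaps at the other heads are the final runs of the rotated lists. For a head [h], being a
    start thus depends on the list of lengths alone and passes to any partition with the same
    list. *)
Lemma is_startP n m (h : 'Z_n) (pi : {fset seq 'Z_n}) : (1 < n)%N ->
  is_ap_partition m pi -> has (predC1 1%N) (lens h pi) ->
  reflect (is_head pi h /\
           forall j, (j <= size (lens h pi))%N -> (trail (rot j (lens h pi)) <= trail (lens h pi))%N)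
          (is_start pi h).
Proof.
move=> hn hpi hns; have hg j : (j < size (lens h pi))%N ->
    gap pi (head 0 (nth [::] (ordered_blocks h pi) j)) = trail (rot j (lens h pi)).
  move=> hj; rewrite (gap_trail hn hpi) (lens_rot hn hpi) //.
  by rewrite (perm_has _ (permEl (perm_rot _ _))).
apply: (iffP andP) => [[hh /forallP hmax]|[hh hmax]]; split => //.
  move=> j; rewrite leq_eqVlt => /orP[/eqP->|hj]; first by rewrite rot_size.
  rewrite -hg // -(gap_trail hn hpi hns); apply: (implyP (hmax _)).
  by apply/(is_headP h _ hpi); exists j.
apply/forallP => x; apply/implyP => /(is_headP h _ hpi)[j hj ->].
by rewrite hg // (gap_trail hn hpi hns) hmax // ltnW.
Qed.

(** A leading 1 could be rotated to the end, making the final run longer. *)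
Lemma head_max_trail ls : has (predC1 1%N) ls ->
  (forall j, (j <= size ls)%N -> (trail (rot j ls) <= trail ls)%N) -> head 1%N ls != 1%N.
Proof.
case: ls => //= l ls hns hmax; apply/eqP => e; move: hns hmax; rewrite e /= => hns.
move=> /(_ 1%N isT); rewrite rot1_cons trail_rcons eqxx -[1%N :: ls]cat1s trail_cat //.
by rewrite ltnn.
Qed.

(** A nonempty prefix contains the head, which is not 1, so its final run is that of a rotation; the
    maximum therefore bounds every run in [count_le_trail]. *)
Lemma count_le_max_trail ls : has (predC1 1%N) ls ->
  (forall j, (j <= size ls)%N -> (trail (rot j ls) <= trail ls)%N) ->
  (count_mem 1%N ls <= trail ls * count (predC1 1%N) ls)%N.
Proof.
move=> hns hmax; have hh := head_max_trail hns hmax.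
have := @count_le_trail (trail ls) ls hh; rewrite leq_add2r; apply=> j hj.
apply: leq_trans (hmax j hj); rewrite /rot.
case: ls hh {hns hmax hj} => // l ls hl; case: j => [|j]; first by [].
by rewrite trail_cat //= hl.
Qed.

(** * From the type and the ceiling condition to [good] lists *)

Lemma big_count_mem (f : nat -> nat) (T ls : seq nat) : uniq T ->
  (\sum_(l <- ls) f l = \sum_(x <- T) f x * count_mem x ls + \sum_(l <- ls | l \notin T) f l)%N.
Proof.
move=> hT; elim: ls => [|l ls IH].
  by rewrite !big_nil big1 // => x _; rewrite muln0.
rewrite !big_cons IH /=.
have -> : (\sum_(x <- T) f x * ((l == x) + count_mem x ls) =
  \sum_(x <- T) f x * (l == x) + \sum_(x <- T) f x * count_mem x ls)%N.
  by rewrite -big_split; apply: eq_bigr => x _; rewrite mulnDr.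
have -> : (\sum_(x <- T) f x * (l == x) = if l \in T then f l else 0)%N.
  case: ifP => hl.
    rewrite (bigD1_seq l) //= eqxx muln1 big1 ?addn0 // => x hx.
    by rewrite eq_sym (negPf hx) muln0.
  rewrite big1_seq // => x /= hx; case: eqP => [e|_]; last by rewrite muln0.
  by rewrite e hx in hl.
by case: (l \in T) => /=; lia.
Qed.

(** The blocks prescribed by the type already cover [n] points in total, which leaves no room for a
    block of any other length. *)
Lemma type_lens n r (i k : nat -> nat) ls :
  (1 < i 2%N)%N ->
  (forall j : nat, (2 <= j < r)%N -> (i j < i j.+1)%N) ->
  n = (k 1 + \sum_(2 <= j < r.+1) k j * i j)%N ->
  all (leq 1) ls -> sumn ls = n -> count_mem 1%N ls = k 1%N ->
  (forall j, (2 <= j <= r)%N -> count_mem (i j) ls = k j) ->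
  (forall l, l \in ls -> l <= maxn 1 (i r))%N /\
  count (predC1 1%N) ls = (\sum_(2 <= j < r.+1) k j)%N.
Proof.
move=> hi2 hi hsum hgt hs h1 hj.
have hmono a b : (2 <= a -> a < b -> b <= r -> i a < i b)%N.
  move=> ha; elim: b => // b IH; rewrite ltnS leq_eqVlt => /orP[/eqP<- hb|hab hb].
    by apply: hi; lia.
  by apply: ltn_trans (IH hab (ltnW hb)) _; apply: hi; lia.
have hgt1 j : (2 <= j <= r)%N -> (1 < i j)%N.
  case/andP; rewrite leq_eqVlt => /orP[/eqP<- //|h2 h3].
  by apply: ltn_trans hi2 (hmono _ _ _ _ _).
pose S := [seq i j | j <- index_iota 2 r.+1]; pose T := 1%N :: S.
have memS x : x \in S -> exists2 j, (2 <= j <= r)%N & x = i j.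
  by case/mapP=> j; rewrite mem_index_iota ltnS => h ->; exists j.
have hT : uniq T.
  rewrite /= map_inj_in_uniq ?iota_uniq ?andbT.
    by apply/negP => /memS[j /hgt1 h e]; rewrite -e in h.
  move=> a b; rewrite !mem_index_iota => ha hb e.
  case: (ltngtP a b) => // hab.
    have := hmono a b; rewrite e ltnn => H; suff: false by []; apply: H; lia.
  have := hmono b a; rewrite e ltnn => H; suff: false by []; apply: H; lia.
have hS (f : nat -> nat) : (\sum_(x <- T) f x * count_mem x ls =
    f 1 * k 1 + \sum_(2 <= j < r.+1) f (i j) * k j)%N.
  rewrite big_cons h1 big_map; congr addn.
  by apply: eq_big_nat => j hjr; rewrite hj //; lia.
have hrest : (\sum_(l <- ls | l \notin T) l = 0)%N.
  have := big_count_mem id ls hT.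
  rewrite -sumnE hs hS hsum mul1n.
  have -> : (\sum_(2 <= j < r.+1) id (i j) * k j = \sum_(2 <= j < r.+1) k j * i j)%N.
    by apply: eq_bigr => j _; rewrite mulnC.
  by move/eqP; rewrite -[X in X == _]addn0 eqn_add2l => /eqP.
have hall l : l \in ls -> l \in T.
  move=> hl; apply/negPn/negP => hlT; have hl1 : (0 < l)%N := allP hgt _ hl.
  move: hrest; rewrite (big_rem l hl) /= hlT => e.
  by move: hl1; rewrite lt0n -leqn0 leqNgt; lia.
split.
  move=> l /hall; rewrite inE => /orP[/eqP->|/memS[j /andP[hj2 hjr] ->]]; first by rewrite leq_maxl.
  rewrite leq_max; apply/orP; right; move: hjr; rewrite leq_eqVlt => /orP[/eqP->//|hjr].
  by apply/ltnW/hmono.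
(* The same regrouping by value, with the indicator of [l != 1] as weight, counts the
   non-singletons. *)
have := big_count_mem (fun l => (l != 1)%N : nat) ls hT.
rewrite [X in _ = (_ + X)%N -> _]big1_seq; last first.
  by move=> l /andP[hl /hall]; rewrite (negPf hl).
rewrite hS /= mul0n add0n addn0 -sum1_count /= => e.
transitivity (\sum_(l <- ls) (l != 1)%N)%N.
  by rewrite big_mkcond; apply: eq_bigr => l _; case: ifP.
rewrite e; apply: eq_big_nat => j hjr.
by have := hgt1 j; case: (i j) => [|[|l]] H; rewrite ?mul1n //; have : false by apply: H; lia.
Qed.

(** As [c] is an integer, rounding the quotient up does not take it past [c]. *)
Lemma ceil_div_le (a b c : nat) : (0 < b)%N -> (a <= c * b)%N ->
  Num.ceil (a%:R / b%:R : rat) <= c%:Z.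
Proof.
move=> hb hab; rewrite ceil_le_int ler_pdivrMr ?ltr0n //.
by rewrite -[c%:~R]/(c%:R) -natrM ler_nat.
Qed.

(** * Undoing the algorithm, and independence of the start *)

Lemma good_catr M ls1 ls2 : has (predC1 1%N) ls2 -> good M (ls1 ++ ls2) -> good M ls2.
Proof. by move=> h; rewrite /good all_cat trail_cat // => /andP[]. Qed.

Lemma good_head ls : head 1%N ls != 1%N -> has (predC1 1%N) ls.
Proof. by case: ls => //= l ls ->. Qed.

(** The new partition has the same list of lengths from [h], so [h] is again a start; and [pi] is
    itself the placement of this list with step [m], so going back recovers it. *)
Lemma separation_from_spec n m m' M (h : 'Z_n) (pi : {fset seq 'Z_n}) : (1 < n)%N ->
  (0 < m <= M)%N -> (0 < m' <= M)%N -> is_ap_partition m pi ->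
  has (predC1 1%N) (lens h pi) -> good M (lens h pi) -> is_start pi h ->
  let rho := separation_from m' h pi in
  [/\ is_ap_partition m' rho, lens h rho = lens h pi, is_start rho h
    & separation_from m h rho = pi].
Proof.
move=> hn hm hm' hpi hns hg hst rho.
have [hh hmax] := elimT (is_startP hn hpi hns) hst.
have [hrho eo] := place_blocks_partition h hn hm' hg (sumn_lens h hn hpi).
rewrite -/(separation_from m' h pi) -/rho in hrho eo.
have el : lens h rho = lens h pi.
  rewrite {1}/lens eo (place_blocks_good h hn hm' hg (sumn_lens h hn hpi)) -map_comp.
  by rewrite -[RHS](greedy_sizes m' [::]); apply: eq_map => B /=; rewrite size_map.
split=> //; last first.
  rewrite /separation_from -/(lens h rho) el -(ordered_blocks_place hn hm hpi hh hns hg).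
  by apply/fsetP => B; rewrite in_fset; apply: mem_ordered.
apply/(is_startP hn hrho); rewrite el //; split=> //.
apply/(is_headP h _ hrho); exists 0%N; first by rewrite el; case: (lens h pi) hns.
have := good_gt0 hg; rewrite eo; case: (lens h pi) hns => //= l ls _ /andP[l0 _].
case: l l0 => //= l _; rewrite mul0n addr0 (@first_free_eq _ _ _ h) //.
by move=> x; rewrite pos_self.
Qed.

(* Cutting the cyclic list of lengths at two starts [h] and [h'] gives two runs
   that both fill intervals, whichever comes first. *)
Lemma separation_from_start n m m' M (h h' : 'Z_n) (pi : {fset seq 'Z_n}) : (1 < n)%N ->
  (0 < m <= M)%N -> (0 < m' <= M)%N -> is_ap_partition m pi ->
  has (predC1 1%N) (lens h pi) -> good M (lens h pi) -> is_start pi h ->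
  has (predC1 1%N) (lens h' pi) -> good M (lens h' pi) -> is_start pi h' ->
  separation_from m' h pi = separation_from m' h' pi.
Proof.
move=> hn hm hm' hpi hns hg hst hns' hg' hst'.
have [hh hmax] := elimT (is_startP hn hpi hns) hst.
have [hh' hmax'] := elimT (is_startP hn hpi hns') hst'.
have [j hj eh'] := elimT (is_headP h h' hpi) hh'.
have el' := lens_rot hn hpi hj; rewrite -eh' in el'.
have hs := sumn_lens h hn hpi.
have hd := head_max_trail hns hmax; have hd' := head_max_trail hns' hmax'.
rewrite el' /rot in hns' hg' hd'.
have eo := ordered_blocks_place hn hm hpi hh hns hg.
set L1 := take j (lens h pi) in hns' hg' hd' el'.
set L2 := drop j (lens h pi) in hns' hg' hd' el'.
have eL : lens h pi = L1 ++ L2 by rewrite cat_take_drop.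
have sL1 : size L1 = j by rewrite size_takel // ltnW.
have sL2 : (0 < size L2)%N by rewrite size_drop subn_gt0.
have hL2 : has (predC1 1%N) L2 by apply: good_head; case: (L2) sL2 hd'.
have hg2 : good M L2 by apply: (@good_catr M L1) => //; rewrite -eL.
(* [L1] is a suffix of the list rotated to [h']. Unless empty, it begins with the first length seen
   from [h], which is not 1, so it has the same final run as that list. *)
have hg1 : good M L1.
  case: (posnP j) => [j0|jgt]; first by rewrite /L1 j0 take0.
  apply: good_catr hg'; apply: good_head.
  by move: hd; rewrite eL; case: (L1) sL1 => //= ej; rewrite -ej in jgt.
have hs12 : (sumn L1 + sumn L2 = n)%N by rewrite -sumn_cat -eL.
(* Reading [pi] itself as the placement of [L1 ++ L2] with step [m] locates [h'] right after the
   interval filled by [L1]. *)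
have ep : h' = embed h (sumn L1).
  rewrite eh' eo eL (place_blocks_cat h hn hm hg1 hg2 hs12) nth_cat.
  rewrite size_map size_greedy sL1 ltnn subnn.
  have := good_gt0 hg2; case: (L2) sL2 => //= l ls _ /andP[l0 _].
  by case: l l0 => //= l _; rewrite /embed /= addr0.
have ep' : embed h' (sumn L2) = h.
  by rewrite ep /embed -addrA -natrD hs12 pchar_Zp // addr0.
apply/fsetP => B; rewrite !in_fset -!/(lens _ pi) el' /rot -/L1 -/L2 eL.
rewrite (place_blocks_cat h hn hm' hg1 hg2 hs12) -ep.
rewrite addnC in hs12; rewrite (place_blocks_cat h' hn hm' hg2 hg1 hs12) ep'.
by rewrite !mem_cat orbC.
Qed.

Lemma exists_start n m (pi : {fset seq 'Z_n}) : (1 < n)%N -> is_ap_partition m pi ->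
  exists h, is_start pi h.
Proof.
move=> hn hpi; have [B [[hB _] _]] := (proj2 hpi) 0.
have h0 : is_head pi (head 0 B) by apply/hasP; exists B.
case: (@arg_maxnP _ (head 0 B) (is_head pi) (gap pi) h0) => h hh hmax.
by exists h; rewrite /is_start hh; apply/forallP => x; apply/implyP; apply: hmax.
Qed.

Lemma separation_startE n m' (pi : {fset seq 'Z_n}) h : is_start pi h ->
  exists2 h', is_start pi h' & separation m' pi = separation_from m' h' pi.
Proof.
move=> hst; rewrite /separation; case: pickP => [h' hst'|/(_ h)]; first by exists h'.
by rewrite hst.
Qed.

(** At a start, the number of singletons is at most the final run times the number of
    non-singletons, so the ceiling in the hypothesis is at most the final run. *)
Lemma ap_partition_start_good n m M r (i k : nat -> nat)
    (hr : (2 <= r)%N) (hi2 : (1 < i 2%N)%N)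
    (hi : forall j : nat, (2 <= j < r)%N -> (i j < i j.+1)%N)
    (hk : forall j : nat, (1 <= j <= r)%N -> (1 <= k j)%N)
    (hsum : n = (k 1 + \sum_(2 <= j < r.+1) k j * i j)%N)
    (hcond : ((M - 1) * (i r - 1))%N%:Z
             <= Num.ceil ((k 1%N)%:R / (\sum_(2 <= j < r.+1) k j)%N%:R : rat))
    (pi : {fset seq 'Z_n}) (h : 'Z_n) : (1 < n)%N ->
  ap_partitions m r i k pi -> is_start pi h ->
  has (predC1 1%N) (lens h pi) /\ good M (lens h pi).
Proof.
move=> hn [hpi [h1 hj]] hst.
have hgt : all (leq 1) (lens h pi).
  by apply/allP => l /mapP[B]; rewrite mem_ordered => /(size_block_gt0 hpi) ? ->.
have [||hle hcnt] := @type_lens n r i k _ hi2 hi hsum hgt (sumn_lens h hn hpi).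
- by rewrite -nblocks_lens.
- by move=> j hjr; rewrite -nblocks_lens hj.
have hK : (0 < \sum_(2 <= j < r.+1) k j)%N.
  by rewrite big_ltn // ltn_addr // hk //; lia.
have hns : has (predC1 1%N) (lens h pi) by rewrite has_count hcnt.
split=> //; have [_ hmax] := elimT (is_startP hn hpi hns) hst.
have := count_le_max_trail hns hmax; rewrite hcnt -nblocks_lens h1 => /(ceil_div_le hK).
move/(le_trans hcond); rewrite lez_nat => hM.
apply/allP => l hl; rewrite (allP hgt _ hl) /=; apply: leq_trans hM.
rewrite leq_mul //; have := hle _ hl; lia.
Qed.

(** Stated for a common bound [M] of the two steps, so that it applies unchanged with [m] and [m']
    interchanged. *)
Lemma separation_inverse n m m' M r (i k : nat -> nat)
    (hm : (0 < m <= M)%N) (hm' : (0 < m' <= M)%N)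
    (hr : (2 <= r)%N) (hi2 : (1 < i 2%N)%N)
    (hi : forall j : nat, (2 <= j < r)%N -> (i j < i j.+1)%N)
    (hk : forall j : nat, (1 <= j <= r)%N -> (1 <= k j)%N)
    (hsum : n = (k 1 + \sum_(2 <= j < r.+1) k j * i j)%N)
    (hcond : ((M - 1) * (i r - 1))%N%:Z
             <= Num.ceil ((k 1%N)%:R / (\sum_(2 <= j < r.+1) k j)%N%:R : rat)) :
  (1 < n)%N ->
  (forall (pi : {fset seq 'Z_n}) h, ap_partitions m r i k pi -> is_start pi h ->
     separation_from m' h pi = separation m' pi) /\
  (forall pi : {fset seq 'Z_n}, ap_partitions m r i k pi ->
     ap_partitions m' r i k (separation m' pi) /\ separation m (separation m' pi) = pi).
Proof.
move=> hn.
have good_start p (pi : {fset seq 'Z_n}) h :=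
  @ap_partition_start_good n p M r i k hr hi2 hi hk hsum hcond pi h hn.
have indep p p' (pi : {fset seq 'Z_n}) h : (0 < p <= M)%N -> (0 < p' <= M)%N ->
    ap_partitions p r i k pi -> is_start pi h -> separation_from p' h pi = separation p' pi.
  move=> hp hp' hpi hst; have [h' hst' ->] := separation_startE p' hst.
  have [hns hg] := good_start _ _ _ hpi hst; have [hns' hg'] := good_start _ _ _ hpi hst'.
  exact: (separation_from_start hn hp hp' (proj1 hpi) hns hg hst hns' hg' hst').
split=> [pi h|pi hpi]; first exact: indep.
have [h hst] := exists_start hn (proj1 hpi).
have [hns hg] := good_start _ _ _ hpi hst.
have [hrho el hst' er] := separation_from_spec hn hm hm' (proj1 hpi) hns hg hst.
(* Both runs of [separation] pick a start of their own; by independence each may be replaced by the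
   same [h]. *)
rewrite -(indep m m' pi h) //.
have hrho' : ap_partitions m' r i k (separation_from m' h pi).
  split=> //; have [h1 hj] := proj2 hpi.
  by split=> [|j hjr]; rewrite (nblocks_lens h) el -nblocks_lens ?h1 ?hj.
by split=> //; rewrite -(indep m' m _ h).
Qed.

Theorem theorem3 (n m m' r : nat) (i k : nat -> nat)
    (hn : (1 <= n)%N) (hm : (1 <= m)%N) (hm' : (1 <= m')%N) (hr : (2 <= r)%N)
    (hi2 : (1 < i 2%N)%N)
    (hi : forall j : nat, (2 <= j < r)%N -> (i j < i j.+1)%N)
    (hk : forall j : nat, (1 <= j <= r)%N -> (1 <= k j)%N)
    (hsum : n = (k 1 + \sum_(2 <= j < r.+1) k j * i j)%N)
    (hcond : ((maxn m m' - 1) * (i r - 1))%N%:Z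
             <= Num.ceil ((k 1%N)%:R / (\sum_(2 <= j < r.+1) k j)%N%:R : rat)) :
  let P := @ap_partitions n m r i k in
  let P' := @ap_partitions n m' r i k in
  let psi := @separation n m' in
  let phi := @separation n m in
  [/\ (* the choice of the starting head is irrelevant *)
      (forall pi h, P pi -> is_start pi h -> separation_from m' h pi = psi pi),
      (forall pi h, P' pi -> is_start pi h -> separation_from m h pi = phi pi),
      set_bij P P' psi,
      set_fun P' P phi
    & (forall pi, P pi -> phi (psi pi) = pi) /\
      (forall pi, P' pi -> psi (phi pi) = pi)].
Proof.
move=> P P' psi phi.
(* Here [n] is at least [k 1 + k 2 * i 2], hence at least 3, so ['Z_n] is the cycle of length
   [n]. *)
have n1 : (1 < n)%N.
  have hk1 : (1 <= k 1)%N by apply: hk; lia.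
  have hk2 : (1 <= k 2)%N by apply: hk; lia.
  rewrite hsum big_ltn //; nia.
have hmM : (0 < m <= maxn m m')%N by rewrite hm leq_maxl.
have hmM' : (0 < m' <= maxn m m')%N by rewrite hm' leq_maxr.
have [ipsi hpsi] := separation_inverse hmM hmM' hr hi2 hi hk hsum hcond n1.
have [iphi hphi] := separation_inverse hmM' hmM hr hi2 hi hk hsum hcond n1.
split=> //; first split.
- by move=> pi /hpsi[].
- move=> pi rho; rewrite !inE => /hpsi[_ e1] /hpsi[_ e2] e.
  by rewrite -e1 -e2 -/psi e.
- by move=> rho /hphi[h1 h2]; exists (phi rho).
- by move=> rho /hphi[].
- by split=> pi; [case/hpsi | case/hphi].
Qed.
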